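(* If $(X,\zeta)_\xi$ is a soft path connected space, then $(X,\zeta)_\xi$ is a soft connected space.
   Context: Parameter sets $\xi$ are nonempty. A soft set over a set $X$ with parameter set $\xi$ is a function $W\colon\xi\to\mathcal{P}(X)$. Soft union, soft intersection and soft inclusion $\widetilde{\sqsubseteq}$ of soft sets with parameter set $\xi$ are taken parameterwise. For $A\subseteq X$, the absolute soft subset $A_\xi$ is the soft set with $A_\xi(e)=A$ for all $e\in\xi$; in particular $\emptyset_\xi$ and $X_\xi$. For $x\in X$, $x\,\widetilde{\in}\,W$ means $x\in W(e)$ for every $e\in\xi$. A soft topology $\zeta$ on $X$ with parameter set $\xi$ is a collection of soft sets over $X$ (with parameter set $\xi$) containing $\emptyset_\xi$ and $X_\xi$ and closed under arbitrary soft unions and under soft intersections of two members; $(X,\zeta)_\xi$ is a soft topological space and members of $\zeta$ are soft open. A soft open neighborhood of $x$ is a $W\in\zeta$ with $x\,\widetilde{\in}\,W$. For $A\subseteq X$, the soft subspace $(A,\zeta_A)_\xi$ has $\zeta_A=\{W_A:W\in\zeta\}$, $W_A(e)=W(e)\cap A$. For a function $\varrho\colon X\to X'$, put $\varrho(W)(e)=\varrho(W(e))$. The mapping $(\mathbb{I}_\xi,\varrho)\colon(X,\zeta)_\xi\to(X',\zeta')_\xi$ is soft continuous if for every $x\in X$ and every soft open neighborhood $W'$ of $\varrho(x)$ there is a soft open neighborhood $W$ of $x$ with $\varrho(W)\,\widetilde{\sqsubseteq}\,W'$. The soft usual topology on $\mathbb{R}$ with parameter set $\xi$ is $\mathscr{U}_\xi=\{H^G_\xi: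 G\subseteq\mathbb{R}\text{ open in the usual topology}\}$, where $H^G_\xi(e)=G$ for all $e\in\xi$; $(I,(\mathscr{U}_\xi)_I)$ is its soft subspace on $I=[0,1]$ (with parameter set $\xi$). A soft path from $x$ to $y$ in $(X,\zeta)_\xi$ is a soft continuous mapping $\Gamma=(\mathbb{I}_\xi,\gamma)\colon(I,(\mathscr{U}_\xi)_I)\to(X,\zeta)_\xi$, where $\gamma\colon I\to X$ is a function with $\gamma(0)=x$, $\gamma(1)=y$. $(X,\zeta)_\xi$ is soft path connected if for all $x,y\in X$ there is a soft path from $x$ to $y$. $(X,\zeta)_\xi$ is soft disconnected if there are nonempty $A,B\subseteq X$ with $A\cup B=X$, $A\cap B=\emptyset$ and both $A_\xi$ and $B_\xi$ soft open; otherwise it is soft connected. *)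

(* Defs.v *)
From mathcomp Require Import all_boot all_order all_algebra.
From mathcomp Require Import all_classical all_reals all_analysis.
Import Order.TTheory GRing.Theory Num.Theory.
Import numFieldNormedType.Exports.

Set Implicit Arguments.
Unset Strict Implicit.
Unset Printing Implicit Defensive.

Local Open Scope classical_set_scope.
Local Open Scope ring_scope.

Definition soft_set (xi X : Type) := xi -> set X.

Definition soft_const (xi X : Type) (A : set X) : soft_set xi X := fun=> A.

Definition soft_bigcup (xi X : Type) (F : set (soft_set xi X)) : soft_set xi X :=
  fun e => \bigcup_(W in F) W e.

Definition soft_setI (xi X : Type) (V W : soft_set xi X) : soft_set xi X :=
  fun e => V e `&` W e.

Definition soft_subset (xi X : Type) (V W : soft_set xi X) : Prop :=
  forall e, V e `<=` W e.

Definition soft_in (xi X : Type) (x : X) (W : soft_set xi X) : Prop :=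
  forall e, W e x.

Definition soft_image (xi X Y : Type) (f : X -> Y) (W : soft_set xi X) :
  soft_set xi Y := fun e => f @` W e.

Definition soft_topology (xi X : Type) (zeta : set (soft_set xi X)) : Prop :=
  [/\ zeta (soft_const set0),
      zeta (soft_const setT),
      (forall F, F `<=` zeta -> zeta (soft_bigcup F)) &
      (forall V W, zeta V -> zeta W -> zeta (soft_setI V W))].

Definition soft_open_nbhd (xi X : Type) (zeta : set (soft_set xi X)) (x : X)
    (W : soft_set xi X) : Prop :=
  zeta W /\ soft_in x W.

(* A subset of A is represented as a set over the subtype [set_type A], so the
   preimage under the inclusion [set_val] stands for [W e `&` A]. *)
Definition soft_restrict (xi X : Type) (A : set X) (W : soft_set xi X) :
  soft_set xi (set_type A) := fun e => @set_val X A @^-1` W e.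
Arguments soft_restrict {xi X} A W e.

Definition soft_subspace (xi X : Type) (zeta : set (soft_set xi X)) (A : set X) :
  set (soft_set xi (set_type A)) := [set soft_restrict A W | W in zeta].
Arguments soft_subspace {xi X} zeta A V : rename.

(* Continuity of the soft mapping that is f on points and the identity on
   parameters. *)
Definition soft_continuous (xi X Y : Type) (zeta : set (soft_set xi X))
    (zeta' : set (soft_set xi Y)) (f : X -> Y) : Prop :=
  forall x W', soft_open_nbhd zeta' (f x) W' ->
    exists2 W, soft_open_nbhd zeta x W & soft_subset (soft_image f W) W'.

Definition soft_usual (xi : Type) (R : realType) : set (soft_set xi R) :=
  [set soft_const G | G in [set G : set R | open G]].
Arguments soft_usual xi R : clear implicits.

Definition unit_itv (R : realType) : set R := `[0, 1].
Arguments unit_itv R : clear implicits.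

Lemma unit_itv_mem0 (R : realType) : 0 \in unit_itv R.
Proof. by rewrite inE /unit_itv /= in_itv /= lexx ler01. Qed.

Lemma unit_itv_mem1 (R : realType) : 1 \in unit_itv R.
Proof. by rewrite inE /unit_itv /= in_itv /= lexx ler01. Qed.

Definition unit_itv0 (R : realType) : set_type (unit_itv R) :=
  exist _ 0 (unit_itv_mem0 R).

Definition unit_itv1 (R : realType) : set_type (unit_itv R) :=
  exist _ 1 (unit_itv_mem1 R).

Definition soft_path (R : realType) (xi X : Type) (zeta : set (soft_set xi X))
    (x y : X) (gamma : set_type (unit_itv R) -> X) : Prop :=
  [/\ soft_continuous (soft_subspace (soft_usual xi R) (unit_itv R)) zeta gamma,
      gamma (unit_itv0 R) = x &
      gamma (unit_itv1 R) = y].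

Definition soft_path_connected (R : realType) (xi X : Type)
    (zeta : set (soft_set xi X)) : Prop :=
  forall x y : X, exists gamma : set_type (unit_itv R) -> X,
    soft_path zeta x y gamma.

Definition soft_disconnected (xi X : Type) (zeta : set (soft_set xi X)) : Prop :=
  exists A B : set X,
    [/\ A !=set0, B !=set0, A `|` B = setT & A `&` B = set0] /\
    (zeta (soft_const A) /\ zeta (soft_const B)).

Definition soft_connected (xi X : Type) (zeta : set (soft_set xi X)) : Prop :=
  ~ soft_disconnected zeta.

(* Main.v *)
Require Import Defs.
From mathcomp Require Import all_boot all_order all_algebra.
From mathcomp Require Import all_classical all_reals all_analysis.

(** A soft path is, pointwise, an ordinary continuous path as far as absolute
    soft subsets are concerned: every soft open set of the usual soft topology
    is constant in the parameter, so soft continuity at [t] gives an honest open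
    neighborhood of [t] in the segment, and the preimage of a set [V] with
    [soft_const V] soft open is relatively open ([preimage_soft_open]).  If
    [A] and [B] disconnected the space, a soft path from a point of [A] to a
    point of [B] would pull them back to a partition of [[0, 1]] into two
    nonempty relatively open sets, contradicting the connectedness of the
    segment. *)

Import Order.TTheory GRing.Theory Num.Theory.
Import numFieldNormedType.Exports.

Set Implicit Arguments.
Unset Strict Implicit.
Unset Printing Implicit Defensive.

Local Open Scope classical_set_scope.
Local Open Scope ring_scope.

(** The open set [G] is the union of the open sets whose trace on [S] is mapped
    into [V]; soft continuity says that these cover the preimage.  An empty
    parameter set would make soft inclusion vacuous, so a parameter is needed to
    read an inclusion of sets off a soft one. *)
Lemma preimage_soft_open (R : realType) (xi X : Type)
    (zeta : set (soft_set xi X)) (S : set R) (f : set_type S -> X)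
    (V : set X) :
  inhabited xi ->
  soft_continuous (soft_subspace (soft_usual xi R) S) zeta f ->
  zeta (soft_const V) ->
  exists2 G : set R, open G & forall t : set_type S, V (f t) <-> G (set_val t).
Proof.
move=> [e] fcont Vopen.
pose F := [set G : set R | open G /\
  forall t : set_type S, G (set_val t) -> V (f t)].
exists (\bigcup_(G in F) G); first by apply: bigcup_open => G [].
move=> t; split => [Vft|[G [_ GV]]]; last exact: GV.
have [_ [[_ [G Gopen <-] <-] Gt] GV] :=
  fcont t (soft_const V) (conj Vopen (fun=> Vft)).
exists G; last exact: Gt e.
split=> // s Gs; apply: (GV e); by exists s.
Qed.

Theorem theorem4p15 (R : realType) (xi X : Type) (zeta : set (soft_set xi X))
    (xi_nonempty : inhabited xi) (zeta_top : soft_topology zeta)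
    (zeta_pc : soft_path_connected R zeta) :
  soft_connected zeta.
Proof.
move=> [A [B [[[x Ax] [y By] AUB AIB] [Aopen Bopen]]]].
have [gamma [gcont g0 g1]] := zeta_pc x y.
have [G Gopen GE] := preimage_soft_open xi_nonempty gcont Aopen.
have [H Hopen HE] := preimage_soft_open xi_nonempty gcont Bopen.
have notAB z : A z -> ~ B z by move=> Az Bz; have: (A `&` B) z by []; rewrite AIB.
have G0 : G 0 by apply/(GE (unit_itv0 R)); rewrite g0.
have H1 : H 1 by apply/(HE (unit_itv1 R)); rewrite g1.
(* The traces of [G] and [H] on the segment are complementary, so the trace of
   [G] is also that of the closed set [~` H]. *)
have GH : unit_itv R `&` G = unit_itv R `&` ~` H.
  apply/seteqP; split=> t [It] tGH; split=> //.
    have /GE At : G (set_val (SigSub (mem_set It))) by [].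
    by move=> Ht; apply: (notAB _ At); apply/HE.
  apply/(GE (SigSub (mem_set It))).
  have : (A `|` B) (gamma (SigSub (mem_set It))) by rewrite AUB.
  by case=> // /HE.
have Iconn : connected (unit_itv R) := @segment_connected R 0 1.
have I0 : unit_itv R 0 := set_mem (unit_itv_mem0 R).
have I1 : unit_itv R 1 := set_mem (unit_itv_mem1 R).
have GI : unit_itv R `&` G = unit_itv R.
  apply: Iconn; first by exists 0.
    by exists G.
  by exists (~` H) => //; exact: open_closedC.
have : (unit_itv R `&` G) 1 by rewrite GI.
by rewrite GH => -[].
Qed.
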